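(* Let $1\le p<\infty$. For any open nonempty set $G\subseteq\ell_p$ there exists a strongly separately continuous function $f:\ell_p\to\mathbb R$ such that $D(f)=G$, where $D(f)$ denotes the set of all points of discontinuity of $f$.
   Context: $\ell_p$ is the space of all real sequences $x=(x_n)_{n=1}^\infty$ with $\sum_{n=1}^\infty|x_n|^p<\infty$, with the topology of the norm $\|x\|_p=(\sum_{n=1}^\infty|x_n|^p)^{1/p}$; openness and (dis)continuity refer to this topology. For $x,a\in\ell_p$ and $k\in\mathbb N$, let $x_k^a$ be the sequence obtained from $x$ by replacing its $k$-th coordinate $x_k$ by $a_k$. A function $f:\ell_p\to\mathbb R$ is strongly separately continuous if for every $a\in\ell_p$ and every $k\in\mathbb N$ one has $\lim_{x\to a}|f(x)-f(x_k^a)|=0$, where $x\to a$ in the norm topology. *)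

(* Defs.v *)
From HB Require Import structures.
From mathcomp Require Import all_boot all_order all_algebra.
From mathcomp Require Import all_classical all_reals all_analysis.

Set Implicit Arguments.
Unset Strict Implicit.
Unset Printing Implicit Defensive.

Import Order.TTheory GRing.Theory Num.Theory.
Import numFieldNormedType.Exports.

Local Open Scope classical_set_scope.
Local Open Scope ring_scope.

Section PowerSum.
Context {R : realType}.
Implicit Types (p : R) (x y : nat -> R).

Definition power_sum p x : \bar R := (\sum_(n <oo) (`|x n| `^ p)%:E)%E.

Lemma power_sum_ge0 p x : (0 <= power_sum p x)%E.
Proof. by apply: nneseries_ge0 => n _ _; rewrite lee_fin powR_ge0. Qed.

Lemma Lnorm_power_sum p x : 1 <= p ->
  ('N[counting]_p%:E[EFin \o x] = power_sum p x `^ p^-1)%E.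
Proof. by move=> p1; rewrite Lnorm_counting // (lt_le_trans ltr01). Qed.

Lemma power_sum_Lnorm p x : 1 <= p ->
  power_sum p x = ('N[counting]_p%:E[EFin \o x] `^ p)%E.
Proof.
move=> p1; rewrite Lnorm_power_sum// -poweRrM mulVf ?poweRe1 ?power_sum_ge0//.
by rewrite gt_eqF// (lt_le_trans ltr01).
Qed.

Lemma power_sum_fin_num p x : (power_sum p x < +oo)%E ->
  power_sum p x \is a fin_num.
Proof. by move=> ?; rewrite ge0_fin_numE ?power_sum_ge0. Qed.

Lemma power_sum0 p : 1 <= p -> power_sum p 0 = 0%E.
Proof.
move=> p1; apply: eseries0 => n _ _ /=.
by rewrite normr0 powR0// gt_eqF// (lt_le_trans ltr01).
Qed.

Lemma power_sumZ p a x :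
  power_sum p (a *: x) = ((`|a| `^ p)%:E * power_sum p x)%E.
Proof.
rewrite /power_sum -nneseriesZl; last by move=> n _; rewrite lee_fin powR_ge0.
by apply: eq_eseriesr => n _ /=; rewrite normrM powRM// EFinM.
Qed.

Lemma minkowski_counting p x y : 1 <= p ->
  ('N[counting]_p%:E[EFin \o (x + y)%R] <=
   'N[counting]_p%:E[EFin \o x] + 'N[counting]_p%:E[EFin \o y])%E.
Proof. by move=> p1; apply: minkowski_EFin. Qed.

Lemma power_sumD p x y : 1 <= p ->
  (power_sum p x < +oo)%E -> (power_sum p y < +oo)%E ->
  (power_sum p (x + y)%R < +oo)%E.
Proof.
move=> p1 xp yp; rewrite power_sum_Lnorm// poweR_lty//.
apply: (le_lt_trans (minkowski_counting x y p1)).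
by rewrite lte_add_pinfty// Lnorm_power_sum// poweR_lty.
Qed.

(* p-summable real sequences; coordinates are numbered from 0 *)
Definition summable_seq p : {pred nat -> R} :=
  [pred x | (power_sum p x < +oo)%E].

Lemma summable_seq_submod_closed p : 1 <= p -> submod_closed (summable_seq p).
Proof.
move=> p1; split; first by rewrite inE power_sum0 ?ltry.
move=> a x y; rewrite !inE => xp yp; apply: power_sumD => //.
rewrite power_sumZ lte_mul_pinfty ?lee_fin ?powR_ge0//.
Qed.

End PowerSum.

(* The space l_p. The proof of 1 <= p is a parameter of the type, so that the
   normed module structure can be inferred. *)
Record lp_space (R : realType) (p : R) (p1 : 1 <= p) := LpSpace {
  lp_seq :> nat -> R ;
  lp_seqP : lp_seq \in summable_seq p }.

Section LpNormed.
Context (R : realType) (p : R) (p1 : 1 <= p).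
Implicit Types x y : lp_space p1.

HB.instance Definition _ := [isSub for @lp_seq R p p1].
HB.instance Definition _ := [Choice of lp_space p1 by <:].

#[local] HB.instance Definition _ :=
  GRing.isSubmodClosed.Build R (nat -> R) (summable_seq p)
    (summable_seq_submod_closed p1).

HB.instance Definition _ := [SubChoice_isSubLmodule of lp_space p1 by <:].

Definition lp_norm x : R := fine (power_sum p x) `^ p^-1.

Lemma lp_norm_Lnorm x : (lp_norm x)%:E = 'N[counting]_p%:E[EFin \o x]%E.
Proof.
by rewrite Lnorm_power_sum// -[in RHS](fineK (power_sum_fin_num (lp_seqP x))).
Qed.

Lemma lp_seqD x y : lp_seq (x + y) = (lp_seq x + lp_seq y)%R.
Proof. exact: (raddfD \val). Qed.

Lemma lp_seqZ (a : R) x : lp_seq (a *: x) = a *: lp_seq x.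
Proof. by []. Qed.

Lemma ler_lp_normD x y : lp_norm (x + y) <= lp_norm x + lp_norm y.
Proof.
have := minkowski_counting (lp_seq x) (lp_seq y) p1.
rewrite -lp_seqD -(lp_norm_Lnorm x) -(lp_norm_Lnorm y) -(lp_norm_Lnorm (x + y)).
by rewrite -EFinD lee_fin.
Qed.

Lemma lp_normZ (a : R) x : lp_norm (a *: x) = `|a| * lp_norm x.
Proof.
have p0 : 0 < p by rewrite (lt_le_trans ltr01).
rewrite /lp_norm lp_seqZ power_sumZ fineM ?power_sum_fin_num//; last exact: lp_seqP.
rewrite powRM ?powR_ge0 ?fine_ge0 ?power_sum_ge0//=.
by rewrite -powRrM mulfV ?gt_eqF// powRr1.
Qed.

Lemma lp_norm0_eq0 x : lp_norm x = 0 -> x = 0.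
Proof.
have p0 : 0 < p by rewrite (lt_le_trans ltr01).
move=> /powR_eq0_eq0 x0; have {}x0 : power_sum p x = 0%E.
  by rewrite -(fineK (power_sum_fin_num (lp_seqP x))) x0.
apply/val_inj/funext => n /=.
have : ((`|x n| `^ p)%:E <= 0)%E.
  rewrite -x0 /power_sum (@nneseriesD1 _ _ n)//.
  apply: leeDl; apply: nneseries_ge0 => k _ _.
  by rewrite lee_fin powR_ge0.
rewrite lee_fin => xn0; apply/normr0_eq0/(@powR_eq0_eq0 _ _ p)/eqP.
by rewrite eq_le xn0 powR_ge0.
Qed.

HB.instance Definition _ := Lmodule_isNormed.Build R (lp_space p1)
  ler_lp_normD lp_normZ lp_norm0_eq0.

Lemma lp_normE x : `|x| = fine (power_sum p x) `^ p^-1.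
Proof. by []. Qed.

Definition replace_coord (x a : nat -> R) (k : nat) : nat -> R :=
  fun n => if n == k then a n else x n.

Lemma replace_coord_summable x a k : replace_coord x a k \in summable_seq p.
Proof.
rewrite inE /power_sum (@nneseriesD1 _ _ k)//.
rewrite lte_add_pinfty ?ltry//.
apply: le_lt_trans (lp_seqP x).
rewrite [leLHS]eseries_mkcond; apply: lee_nneseries => n _ /=.
  by case: ifP => // _ _; rewrite lee_fin powR_ge0.
by rewrite /replace_coord; case: eqVneq => //= _; rewrite lee_fin powR_ge0.
Qed.

(* x_k^a, with the k-th coordinate of x replaced by that of a *)
Definition lp_replace x a k : lp_space p1 :=
  LpSpace p1 (replace_coord_summable x a k).

(* [x --> a] does not exclude x = a; this is harmless, since the expression
   vanishes at x = a. *)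
Definition strongly_separately_continuous (f : lp_space p1 -> R) : Prop :=
  forall (a : lp_space p1) (k : nat),
    `|f x - f (lp_replace x a k)| @[x --> a] --> 0.

Definition discontinuity_set (f : lp_space p1 -> R) : set (lp_space p1) :=
  [set x | ~ {for x, continuous f}].

End LpNormed.

(* Main.v *)
(* Let E be the subspace of eventually zero sequences and phi a continuous
   nonnegative function vanishing exactly off G (a distance to the complement);
   then f = 1_E * phi works. Replacing one coordinate does not affect membership
   in E and moves x no farther from a, so f is strongly separately continuous.
   Both E and its complement are dense, so f is discontinuous wherever
   phi > 0, while 0 <= f <= phi forces continuity where phi = 0. *)
Require Import Defs.
From mathcomp Require Import all_boot all_order all_algebra.
From mathcomp Require Import all_classical all_reals all_analysis.

Import Order.TTheory GRing.Theory Num.Theory.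
Import numFieldNormedType.Exports.
Local Open Scope classical_set_scope.
Local Open Scope ring_scope.

(** The distance to [F] works: where it is 0, every ball meets [F], and [F] is closed. For empty [F]
    that distance is infinite, so the constant 1 replaces it. *)
Lemma closed_zero_set {R : realType} {V : normedModType R} (F : set V) :
  closed F -> exists phi : V -> R,
    [/\ continuous phi, forall x, 0 <= phi x & forall x, phi x = 0 <-> F x].
Proof.
move=> cF; have [->|/set0P[a Fa]] := eqVneq F set0.
  exists (fun=> 1); split=> [x|x|x]; first exact: cvg_cst.
    exact: ler01.
  by split=> // /eqP; rewrite oner_eq0.
have dfin x : edist_inf F x \is a fin_num.
  rewrite ge0_fin_numE ?edist_inf_ge0//.
  apply: (@le_lt_trans _ _ (edist (x, a))).
    by apply: ereal_inf_lbound; exists a.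
  rewrite -ge0_fin_numE ?edist_ge0//; apply/edist_finP => /=.
  by exists (`|x - a| + 1); rewrite ?ltr_wpDl// -ball_normE/= ltrDl.
exists (fine \o edist_inf F); split=> [x|x|x].
- by apply: fine_cvg; rewrite fineK//; exact: edist_inf_continuous.
- exact/fine_ge0/edist_inf_ge0.
split=> [d0|Fx]; last by rewrite /= edist_inf0.
apply: cF => B /nbhs_ballP[e /= e0 xeB].
have : (edist_inf F x < e%:E)%E.
  by rewrite -[edist_inf F x]fineK// [fine _]d0 lte_fin.
case/ereal_inf_lt => _ [z Fz <-] /edist_lt_ball xez.
by exists z; split=> //; exact: xeB.
Qed.

Lemma discontinuous_indic_mul {R : realType} {T : topologicalType} (E : set T)
    (phi : T -> R) (x : T) :
    closure E = setT -> closure (~` E) = setT -> continuous phi ->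
    (forall z, 0 <= phi z) ->
  ~ {for x, continuous (fun z => \1_E z * phi z)} <-> phi x <> 0.
Proof.
move=> dE dCE cphi phi_ge0; split=> [nc phix0|phix].
  apply: nc; rewrite /prop_for /continuous_at phix0 mulr0.
  apply: (@squeeze_cvgr _ _ _ _ (cst 0) phi); last by rewrite -phix0; exact: cphi.
    apply: nearW => z; rewrite mulr_ge0//= indicE.
    by case: (_ \in _); rewrite ?mul1r ?mul0r ?lexx.
  exact: cvg_cst.
have phix_gt0 : 0 < phi x by rewrite lt_neqAle phi_ge0 eq_sym andbT; apply/eqP.
(* Half of [phi x] defeats continuity in both cases. If [x] is in [E], a nearby point outside [E]
   gives a jump of [phi x]; otherwise a nearby [z] in [E] gives a jump of [phi z], which exceeds
   [phi x / 2] near [x]. *)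
move=> /cvgrPdist_lt/(_ (phi x / 2)) cf.
have cl A : closure A = setT -> closure A x by move=> ->.
have h0 : 0 < phi x / 2 by rewrite divr_gt0.
have {cf} := cf h0.
have [Ex|nEx] := pselect (E x).
  move=> /(cl _ dCE)[z [nEz]].
  rewrite /= !indicE (mem_set Ex) (memNset nEz) mul1r mul0r subr0 gtr0_norm//.
  by rewrite ltr_pMr// invf_gt1// ltNge ler1n.
move=> near_f.
have near_phi : \forall z \near x, phi x / 2 < phi z.
  apply: (cvgr_gt _ (cphi x)).
  by rewrite ltr_pdivrMr// ltr_pMr// ltr1n.
have [z [Ez /=]] := cl _ dE _ (filterI near_f near_phi).
rewrite !indicE (mem_set Ez) (memNset nEx) mul1r mul0r sub0r normrN ger0_norm//.
by move=> [/lt_trans h /h]; rewrite ltxx.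
Qed.

Lemma cvg_nonexpansive {R : realType} {V : normedModType R} (g : V -> V) (a : V) :
  (forall x, `|a - g x| <= `|a - x|) -> g x @[x --> a] --> a.
Proof.
move=> ga; apply/cvgrPdist_lt => e e0; near=> x.
by apply: (le_lt_trans (ga x)); near: x; exact: cvgr_dist_lt.
Unshelve. all: by end_near. Qed.

(** Invariance lets [u x] factor out of the difference, so [u] need not be continuous: what remains
    is at most [|phi x - phi (g x)|], and both terms tend to [phi a]. *)
Lemma cvg_dist_mul_invariant {R : realType} {V : normedModType R}
    (u phi : V -> R) (g : V -> V) (a : V) :
    (forall x, `|u x| <= 1) -> (forall x, u (g x) = u x) ->
    {for a, continuous phi} -> g x @[x --> a] --> a ->
  `|u x * phi x - u (g x) * phi (g x)| @[x --> a] --> 0.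
Proof.
move=> u1 ug cphi ga.
have h : `|phi x - phi (g x)| @[x --> a] --> 0.
  rewrite -(normr0 R) -(subrr (phi a)); apply: cvg_norm; apply: cvgB => //.
  exact: cvg_comp ga cphi.
apply: squeeze_cvgr h; last exact: cvg_cst.
by apply: nearW => x; rewrite normr_ge0 /= ug -mulrBr normrM ler_piMl.
Qed.

Section LpSpace.
Context {R : realType} {p : R} {p1 : 1 <= p}.
Implicit Types x y a : lp_space p1.

Lemma lp_norm_le_powR x (e : R) : 0 <= e ->
  (power_sum p x <= (e `^ p)%:E)%E -> `|x| <= e.
Proof.
move=> e0 xe; have p0 : 0 < p by rewrite (lt_le_trans ltr01).
rewrite lp_normE -[leRHS](powRr1 e0) -(mulfV (lt0r_neq0 p0)) powRrM.
rewrite ge0_ler_powR ?nnegrE ?invr_ge0 ?powR_ge0 ?(ltW p0)//.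
  exact/fine_ge0/power_sum_ge0.
rewrite -lee_fin fineK//; exact/power_sum_fin_num/lp_seqP.
Qed.

Lemma lp_norm_mono x y : (forall n, `|x n| <= `|y n|) -> `|x| <= `|y|.
Proof.
move=> xy; apply: lp_norm_le_powR => //.
have p0 : 0 < p by rewrite (lt_le_trans ltr01).
rewrite lp_normE -powRrM mulVf ?gt_eqF// powRr1 ?fine_ge0 ?power_sum_ge0//.
rewrite fineK; last exact/power_sum_fin_num/lp_seqP.
apply: lee_nneseries => n _; first by rewrite lee_fin powR_ge0.
by rewrite lee_fin ge0_ler_powR ?nnegrE ?(ltW p0).
Qed.

Lemma lp_seqB x y n : (x - y) n = x n - y n.
Proof. by rewrite lp_seqD -scaleN1r lp_seqZ scaleN1r. Qed.

(** The difference from [a] loses its [k]-th coordinate and keeps all the others. *)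
Lemma cvg_lp_replace a k : lp_replace x a k @[x --> a] --> a.
Proof.
apply: cvg_nonexpansive => x; apply: lp_norm_mono => n.
rewrite !lp_seqB /= /replace_coord.
by case: ifP => _; rewrite ?subrr ?normr0.
Qed.

Definition eventually_zero : set (lp_space p1) :=
  [set x | exists N, forall n, (N <= n)%N -> x n = 0].

Lemma eventually_zero_replace x a k :
  eventually_zero (lp_replace x a k) <-> eventually_zero x.
Proof.
(* Past index [k] the two sequences coincide. *)
split=> -[N xN]; exists (maxn N k.+1) => n; rewrite geq_max => /andP[Nn kn].
  by have := xN _ Nn; rewrite /= /replace_coord gtn_eqF.
by rewrite /= /replace_coord gtn_eqF// xN.
Qed.

Definition truncate (x : nat -> R) (N : nat) : nat -> R :=
  fun n => if (n < N)%N then x n else 0.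

Lemma truncate_summable x N : truncate x N \in summable_seq p.
Proof.
have p0 : 0 < p by rewrite (lt_le_trans ltr01).
rewrite inE; apply: le_lt_trans (lp_seqP x).
apply: lee_nneseries => n _; first by rewrite lee_fin powR_ge0.
rewrite lee_fin ge0_ler_powR ?nnegrE ?(ltW p0)// /truncate.
by case: ifP => //; rewrite normr0.
Qed.

(** Truncations of [x] approach [x], since the [p]-th power of the error is a tail of a convergent
    series. *)
Lemma closure_eventually_zero : closure eventually_zero = setT.
Proof.
have p0 : 0 < p by rewrite (lt_le_trans ltr01).
rewrite -subTset => x _ B /nbhs_ballP[e /= e0 xeB].
have := @nneseries_tail_cvg _ (fun n => (`|x n| `^ p)%:E) xpredT (lp_seqP x).
move=> /(_ (fun n _ => powR_ge0 _ _))/fine_cvgP[].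
move=> Tfin /cvgrPdist_lt/(_ ((e / 2) `^ p)).
rewrite powR_gt0 ?divr_gt0// => /(_ isT) Tlt.
(* Finiteness is kept alongside the bound because [fine] sends an infinite tail to 0. *)
have [N _ NP] := filterI Tfin Tlt.
have [/= TN] := NP N (leqnn N); rewrite sub0r normrN => TNe.
exists (LpSpace p1 (truncate_summable x N)); split.
  by exists N => n Nn /=; rewrite /truncate ltnNge Nn.
apply: xeB; rewrite -ball_normE /=.
apply: (@le_lt_trans _ _ (e / 2)); last by rewrite gtr_pMr// invf_lt1// ltr1n.
apply: lp_norm_le_powR; first by rewrite divr_ge0// ltW.
apply: (@le_trans _ _ (\sum_(N <= k <oo) (`|x k| `^ p)%:E)%E); last first.
  by rewrite -[leLHS]fineK// lee_fin (le_trans (ler_norm _))// ltW.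
(* The tail becomes a full series with zero terms below [N], so the comparison is termwise. *)
rewrite eseries_cond eseries_mkcond; apply: lee_nneseries => n _.
  by rewrite lee_fin powR_ge0.
rewrite lp_seqB /= /truncate; case: ltnP => _ //=.
  by rewrite subrr normr0 powR0 ?gt_eqF.
by rewrite subr0.
Qed.

(** This supplies an element of the space with no zero coordinate. Its terms lie in (0, 1] and
    [1 <= p], so [p]-th powers only shrink them. *)
Lemma geometric_half_summable :
  (fun n => 1 / (2 ^ n.+1)%:R : R) \in summable_seq p.
Proof.
rewrite inE; apply: (@le_lt_trans _ _ 1%:E); last exact: ltry.
apply: le_trans (epsilon_trick0 xpredT ler01).
apply: lee_nneseries => n _; first by rewrite lee_fin powR_ge0.
rewrite lee_fin ger0_norm ?divr_ge0// ge1r_powR//.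
rewrite divr_gt0 ?ltr0n ?expn_gt0//= ler_pdivrMr ?ltr0n ?expn_gt0//.
by rewrite mul1r ler1n expn_gt0.
Qed.

Lemma closureC_eventually_zero : closure (~` eventually_zero) = setT.
Proof.
rewrite -subTset => x _ B /nbhs_ballP[e /= e0 xeB].
have [[N xN]|nx] := pselect (eventually_zero x); last first.
  by exists x; split=> //; apply: xeB; exact: ballxx.
pose y := LpSpace p1 geometric_half_summable.
(* The added 1 keeps the denominator positive and makes the perturbation strictly shorter than
   [e]. *)
have c0 : 0 < e / (`|y| + 1) by rewrite divr_gt0// ltr_wpDl.
exists (x + (e / (`|y| + 1)) *: y); split.
  (* At this index [x] already vanishes, leaving a nonzero multiple of a coordinate of [y]. *)
  move=> [M xyM]; have := xyM (maxn N M) (leq_maxr _ _).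
  rewrite lp_seqD lp_seqZ /= [LHS]/GRing.add /= xN ?leq_maxl// add0r => /eqP.
  by apply/negP; rewrite mulf_neq0 ?gt_eqF// divr_gt0 ?ltr0n ?expn_gt0.
apply: xeB; rewrite -ball_normE /= opprD addNKr normrN normrZ gtr0_norm//.
by rewrite mulrAC ltr_pdivrMr ?ltr_wpDl// ltr_pM2l// ltrDl.
Qed.

End LpSpace.

Theorem theorem4p1 (R : realType) (p : R) (p1 : 1 <= p) (G : set (lp_space p1)) :
  open G -> G !=set0 ->
  exists f : lp_space p1 -> R,
    strongly_separately_continuous f /\ discontinuity_set f = G.
Proof.
move=> oG _; have [phi [cphi phi_ge0 phi0]] := closed_zero_set _ (open_closedC oG).
pose E : set (lp_space p1) := eventually_zero.
exists (fun x => \1_E x * phi x); split=> [a k|].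
  apply: (@cvg_dist_mul_invariant _ (lp_space p1) \1_E phi
    (fun x => lp_replace x a k)).
- by move=> x; rewrite indicE ger0_norm// lern1 leq_b1.
- move=> x; rewrite !indicE; congr (nat_of_bool _)%:R.
  apply: asbool_equiv_eq; exact: eventually_zero_replace.
- exact: cphi.
- exact: cvg_lp_replace.
(* Discontinuity at [x] amounts to [phi x <> 0], and [phi] vanishes exactly on the complement of
   [G]. *)
apply/seteqP; split=> x.
  move=> /(discontinuous_indic_mul _ _ _ closure_eventually_zero
    closureC_eventually_zero cphi phi_ge0) phix.
  by apply: contrapT => Gx; apply: phix; exact/phi0.
move=> Gx; apply/(discontinuous_indic_mul _ _ _ closure_eventually_zero
  closureC_eventually_zero cphi phi_ge0).
by move=> /phi0; exact.
Qed.
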